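(* Let $\ell\ge 0$ and $k,n\ge 1$ be integers such that $1<k<\left\lfloor\frac n2\right\rfloor$, and let $$\tilde L_\ell^k(n):=\max_{0\le p\le \ell}\left(\left\lfloor\frac{(p+1)n}{k}\right\rfloor-1+W_{\ell-p}(k)\right).$$ Then $\tilde L_\ell^k(n)\le RU_\ell^k(n)\le \tilde L_\ell^k(n)+2\ell+1$.
   Context: Bounded Rényi–Ulam game (adaptive). The Responder thinks of a number from $\{1,\dots,n\}$ and the Questioner has to find it. In each round the Questioner asks whether the sought number belongs to a chosen subset of $\{1,\dots,n\}$ with at most $k$ elements, and the Responder immediately answers YES or NO; the Responder may lie at most $\ell\ge0$ times in total during the game. $RU_\ell^k(n)$ denotes the minimum number of queries needed for the Questioner to surely find the unknown number (i.e. in the worst case). For integers $\ell\ge0$, $n\ge1$, the weight bound is $$W_\ell(n):=\min\left\{q: n\le \frac{2^q}{\binom{q}{\le \ell}}\right\},\qquad \binom{q}{\le \ell}:=\sum_{j=0}^{\ell}\binom qj,$$ where $q$ ranges over the nonnegative integers. *)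

(* Defs.v *)
From mathcomp Require Import all_boot all_order all_algebra.
From mathcomp Require Import boolp classical_sets.

Set Implicit Arguments.
Unset Strict Implicit.
Unset Printing Implicit Defensive.

Definition is_least (P : nat -> Prop) (q : nat) : Prop :=
  P q /\ forall r, P r -> q <= r.

(* The value is 0 when no number satisfies P; [weight_bound_is_least] and
   [RU_is_least] show that this does not happen in the uses below (as soon as
   there are at least one number and queries of size at least 1). *)
Definition least (P : nat -> Prop) : nat := xget 0 [set q | is_least P q]%classic.

Lemma leastP (P : nat -> Prop) : (exists q, P q) -> is_least P (least P).
Proof.
move=> [q Pq]; apply: (@xgetPex _ 0 [set q | is_least P q]%classic).
have exP : exists q, `[< P q >] by exists q; apply/asboolP.
case: (ex_minnP exP) => m /asboolP Pm minm; exists m; split=> // r Pr.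
by apply: minm; apply/asboolP.
Qed.

Definition binom_le (q l : nat) : nat := \sum_(j < l.+1) 'C(q, j).

Definition weight_bound (l n : nat) : nat :=
  least (fun q => (n%:R <= 2 ^+ q / (binom_le q l)%:R :> rat)%R).

(* An adaptive strategy of the Questioner searching for an element of 'I_n:
   [Announce y] stops the game, claiming that the sought number is y, and
   [Ask A ty tn] asks whether it lies in A, going on with ty after the answer
   YES and with tn after the answer NO. *)
Inductive strategy (n : nat) : Type :=
| Announce of 'I_n
| Ask of {set 'I_n} & strategy n & strategy n.

Arguments Announce {n}.
Arguments Ask {n}.

Fixpoint queries_bounded (n k : nat) (t : strategy n) : bool :=
  if t is Ask A ty tn
  then [&& #|A| <= k, queries_bounded k ty & queries_bounded k tn]
  else true.

Fixpoint max_queries (n : nat) (t : strategy n) : nat :=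
  if t is Ask _ ty tn then (maxn (max_queries ty) (max_queries tn)).+1 else 0.

(* [ans i] is the answer (true for YES) given in round i; answers beyond the
   end of the game are irrelevant. Since a strategy is deterministic, an
   adaptive Responder gains nothing over a fixed sequence of answers once all
   sequences are considered. *)
Fixpoint announced (n : nat) (t : strategy n) (ans : nat -> bool) : 'I_n :=
  match t with
  | Announce y => y
  | Ask _ ty tn => announced (if ans 0 then ty else tn) (fun i => ans i.+1)
  end.

Fixpoint lies (n : nat) (x : 'I_n) (t : strategy n) (ans : nat -> bool) : nat :=
  match t with
  | Announce _ => 0
  | Ask A ty tn => (ans 0 != (x \in A))
                   + lies x (if ans 0 then ty else tn) (fun i => ans i.+1)
  end.

Definition surely_finds (n l : nat) (t : strategy n) : Prop :=
  forall (x : 'I_n) (ans : nat -> bool), lies x t ans <= l -> announced t ans = x.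

(* The sought number ranges over 'I_n = {0, ..., n-1} instead of {1, ..., n}. *)
Definition RU (l k n : nat) : nat :=
  least (fun q => exists t : strategy n,
    [/\ queries_bounded k t, surely_finds l t & max_queries t = q]).

(* For 0 < k <= n the quotient is positive, so that the subtraction is exact. *)
Definition L_tilde (l k n : nat) : nat :=
  \max_(p < l.+1) (((p.+1 * n) %/ k - 1) + weight_bound (l - p) k).

Lemma binom_le_gt0 q l : 0 < binom_le q l.
Proof. by rewrite /binom_le big_ord_recl bin0. Qed.

Lemma weight_boundE q l n :
  (n%:R <= 2 ^+ q / (binom_le q l)%:R :> rat)%R = (n * binom_le q l <= 2 ^ q).
Proof.
have B0 : (0 < (binom_le q l)%:R :> rat)%R by rewrite Num.Theory.ltr0n binom_le_gt0.
by rewrite Num.Theory.ler_pdivlMr // -GRing.natrM -GRing.natrX Num.Theory.ler_nat.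
Qed.

Lemma binom_le_exp q l : binom_le q l <= q.+1 ^ l.
Proof.
elim: l => [|l IHl]; first by rewrite /binom_le big_ord_recl big_ord0 bin0.
have binX m r : 'C(m, r) <= m ^ r.
  apply: (@leq_trans (m ^_ r)); first by rewrite -bin_ffact leq_pmulr // fact_gt0.
  by elim: r => // r IHr; rewrite ffactnSr expnSr leq_mul // leq_subr.
rewrite /binom_le big_ord_recr /= expnS mulSn leq_add //.
apply: leq_trans (binX _ _) _; rewrite expnS leq_mul2l; apply/orP; right.
by case: l {IHl} => // l; rewrite leq_exp2r.
Qed.

Lemma weight_bound_is_least l n :
  is_least (fun q => (n%:R <= 2 ^+ q / (binom_le q l)%:R :> rat)%R)
           (weight_bound l n).
Proof.
apply: leastP; pose c := 2 * (l + n); exists (2 ^ (2 * c)).-1.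
rewrite weight_boundE.
apply: leq_trans (_ : 2 ^ n * (2 ^ (2 * c)) ^ l <= _).
  apply: leq_mul; first exact/ltnW/ltn_expl.
  by have := binom_le_exp (2 ^ (2 * c)).-1 l; rewrite prednK ?expn_gt0.
rewrite -expnM -expnD leq_exp2l // -ltnS prednK ?expn_gt0 //.
have lt2 := ltn_expl c (isT : 1 < 2).
have: c.+1 * c.+1 <= 2 ^ (2 * c) by rewrite mul2n -addnn expnD leq_mul.
have le_nc : n <= c by rewrite /c mulnDr mul2n mul2n -!addnn !addnA leq_addl.
have le_cl : 2 * c * l <= c * c.
  by rewrite mulnAC mulnC leq_mul2l /c leq_mul2l leq_addr !orbT.
apply: leq_trans; rewrite [c.+1 * _]mulSn addSn ltnS leq_add // (leq_trans le_cl) //.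
by rewrite leq_mul2l leqnSn orbT.
Qed.

Definition tally n (s : seq {set 'I_n}) (a : seq bool) (x : 'I_n) : nat :=
  sumn [seq (p.2 != (x \in p.1) : nat) | p : {set 'I_n} * bool <- zip s a].

Fixpoint ask_all n (s : seq {set 'I_n}) (dec : seq bool -> 'I_n) : strategy n :=
  if s is A :: s'
  then Ask A (ask_all s' (fun a => dec (true :: a)))
             (ask_all s' (fun a => dec (false :: a)))
  else Announce (dec [::]).

Lemma announced_ask_all n (s : seq {set 'I_n}) dec ans :
  announced (ask_all s dec) ans = dec (mkseq ans (size s)).
Proof.
elim: s dec ans => //= A s IHs dec ans.
rewrite /mkseq /= (iotaDl 1 0) -map_comp.
by case: (ans 0); rewrite IHs.
Qed.

Lemma lies_ask_all n (s : seq {set 'I_n}) dec ans x :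
  lies x (ask_all s dec) ans = tally s (mkseq ans (size s)) x.
Proof.
elim: s dec ans => //= A s IHs dec ans.
rewrite /tally /mkseq /= (iotaDl 1 0) -map_comp; congr (_ + _).
by case: (ans 0); rewrite IHs.
Qed.

Lemma ask_all_bounded n k (s : seq {set 'I_n}) dec :
  all (fun A : {set 'I_n} => #|A| <= k) s -> queries_bounded k (ask_all s dec).
Proof.
by elim: s dec => //= A s IHs dec /andP[-> sk]; rewrite !IHs.
Qed.

Lemma tally_separates n (s : seq {set 'I_n}) a x y : size a = size s ->
  count (fun A : {set 'I_n} => (x \in A) != (y \in A)) s
  <= tally s a x + tally s a y.
Proof.
elim: s a => [|A s IHs] [|b a] //= [/IHs le_s]; rewrite /tally /=.
rewrite addnACA leq_add //.
by case: b; case: (x \in A); case: (y \in A).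
Qed.

Lemma strategy_exists l k n (y0 : 'I_n) : 0 < k ->
  exists t : strategy n, queries_bounded k t /\ surely_finds l t.
Proof.
move=> k0; pose s := flatten [seq nseq l.*2.+1 [set x] | x <- enum 'I_n].
pose dec a := odflt y0 [pick x | tally s a x <= l].
exists (ask_all s dec); split.
  apply/ask_all_bounded/allP => A /flattenP[r /mapP[x _ ->]].
  by move=> /nseqP[-> _]; rewrite cards1.
move=> x ans; rewrite lies_ask_all announced_ask_all => lx.
rewrite /dec; case: pickP => [y /= ly|/(_ x)]; last by rewrite lx.
apply/eqP; apply: contraT => nyx.
have := tally_separates x y (size_mkseq ans (size s)).
rewrite leqNgt => /negP; case.
apply: (@leq_ltn_trans l.*2); first by rewrite -addnn leq_add.
rewrite /s count_flatten -map_comp.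
have: x \in enum 'I_n by rewrite mem_enum.
elim: (enum _) => //= z r IHr; rewrite inE => /orP[/eqP <-|/IHr].
  rewrite /= count_nseq !inE eqxx (negPf nyx) mul1n.
  by apply: leq_trans (leq_addr _ _).
by move=> h; apply: leq_trans h _; rewrite leq_addl.
Qed.

Lemma RU_is_least l k n : 0 < k -> 0 < n ->
  is_least (fun q => exists t : strategy n,
    [/\ queries_bounded k t, surely_finds l t & max_queries t = q]) (RU l k n).
Proof.
move=> k0 n0; apply: leastP.
have [t [bt ft]] := strategy_exists l (Ordinal n0) k0.
by exists (max_queries t), t.
Qed.

(* Main.v *)
Require Import Defs.
From mathcomp Require Import all_boot all_order all_algebra.
From mathcomp Require Import zify.

Set Implicit Arguments.
Unset Strict Implicit.
Unset Printing Implicit Defensive.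

(* Lower bound: put m = l - p and give each number x the level
   f x = (p + 1) - (lies spent on x), truncated at 0. Each NO lowers the total
   level (p + 1) n by at most k. The Responder says NO while at least k levels
   stay positive. When this is about to fail, fewer than 2k positive levels
   remain, and their total still forces Berlekamp's weight to exceed 2 ^ q for
   the number q of remaining queries: levels may be made equal without increasing
   the weight, and equal levels can be halved.

   Upper bound: sweep cyclically through blocks of k numbers until a block A gets
   the answer YES, then repeat A. A later NO cancels one YES, at the cost of two
   queries and one lie for every number; otherwise A is confirmed after at most
   l - p + 1 queries and the search goes on inside A, where W + (l - p) queries
   suffice by the argument of Rivest, Meyer, Kleitman, Winklmann and Spencer. *)

(** * Partial sums of binomial coefficients *)

Definition bsum (q j : nat) : nat := \sum_(i < j) 'C(q, i).

Lemma bsum0 q : bsum q 0 = 0.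
Proof. by rewrite /bsum big_ord0. Qed.

Lemma bsumSr q j : bsum q j.+1 = bsum q j + 'C(q, j).
Proof. by rewrite /bsum big_ord_recr. Qed.

Lemma bsum_pascal q j : bsum q.+1 j = bsum q j + bsum q j.-1.
Proof.
case: j => [|j]; first by rewrite !bsum0.
elim: j => [|j IHj]; first by rewrite !bsumSr !bsum0 !bin0.
by rewrite bsumSr IHj /= binS !bsumSr /=; lia.
Qed.

Lemma leq_bsum q i j : i <= j -> bsum q i <= bsum q j.
Proof.
by move/subnKC <-; elim: (j - i) => [|d IHd]; rewrite ?addn0 // addnS bsumSr; lia.
Qed.

(** By the symmetry of binomial coefficients, the second sum is the tail that the first one leaves
    out. *)
Lemma bsum_compl q j : bsum q j + bsum q (q.+1 - j) = 2 ^ q.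
Proof.
elim: q j => [|q IHq] j.
  case: j => [|j]; first by rewrite bsum0 /bsum big_ord1.
  rewrite subSS sub0n bsum0 addn0.
  by elim: j => [|j IHj]; rewrite bsumSr ?bsum0 // IHj bin0n.
rewrite !bsum_pascal expnS; case: j => [|j].
  have := IHq q.+2; have := IHq q.+1.
  have -> : q.+1 - q.+2 = 0 by lia.
  by rewrite subnn subn0 !bsum0 /=; lia.
have := IHq j.+1; have := IHq j.
have -> : (q.+2 - j.+1).-1 = q.+1 - j.+1 by lia.
by rewrite [q.+2 - _]subSS /=; lia.
Qed.

Lemma bsum_le_exp q j : bsum q j <= 2 ^ q.
Proof. by rewrite -(bsum_compl q j) leq_addr. Qed.

Lemma bsum_gt0 q j : 0 < j -> 0 < bsum q j.
Proof.
by move=> j0; apply: leq_trans (leq_bsum q j0); rewrite bsumSr bsum0 bin0.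
Qed.

(** The first [i] coefficients and the last [j], reflected, cover the whole row and overlap. *)
Lemma bsum_pair q i j : 0 < i -> 0 < j -> q.+1 < i + j ->
  2 ^ q < bsum q i + bsum q j.
Proof.
move=> i0 j0 ij; rewrite -(bsum_compl q i) ltn_add2l.
apply: leq_trans (@leq_bsum q (q.+1 - i).+1 j _); last by lia.
by rewrite bsumSr -[X in X < _]addn0 ltn_add2l bin_gt0; lia.
Qed.

(** The index [i] is at least as far from the middle of row [q] as [j]. *)
Lemma leq_bin_unimodal q i j : i <= j -> i + j <= q -> 'C(q, i) <= 'C(q, j).
Proof.
elim: q i j => [|q IHq] [|i] [|j] ij ijq; rewrite ?bin0 ?bin_gt0 //; try lia.
have [ijS|ijS] := leqP (i + j).+2 q.
  by rewrite !binS leq_add // IHq; lia.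
have -> : i.+1 = q.+1 - j.+1 by lia.
by rewrite bin_sub //; lia.
Qed.

(** * Levels, levelling, and the weight they force *)

Section Transfer.
Variable T : finType.
Implicit Types (f : T -> nat) (A B S : {set T}).

Lemma subset_card_ex A r : r <= #|A| -> exists2 B : {set T}, B \subset A & #|B| = r.
Proof.
elim: r => [|r IHr] rA; first by exists set0; rewrite ?sub0set ?cards0.
have [B BA Br] := IHr (ltnW rA).
have /subsetPn[x xA xB] : ~~ (A \subset B).
  by apply/negP => /subset_leq_card; lia.
by exists (x |: B); rewrite ?subUset ?sub1set ?xA // cardsU1 xB Br.
Qed.

Lemma sum_mem A : \sum_x ((x \in A) : nat) = #|A|.
Proof.
by rewrite -sum1_card [RHS]big_mkcond; apply: eq_bigr => x _; case: (x \in A).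
Qed.

Lemma card_remove f A : #|[set x | 0 < f x]| <= #|[set x | 0 < f x - (x \in A)]| + #|A|.
Proof.
apply: leq_trans (leq_card_setU _ _); apply/subset_leq_card/subsetP => x.
by rewrite !inE; case: (x \in A); rewrite ?orbT // subn0 orbF.
Qed.

Lemma sum_remove f A : \sum_x f x <= \sum_x (f x - (x \in A)) + #|A|.
Proof.
rewrite -sum_mem -big_split; apply: leq_sum => x _ /=; lia.
Qed.

Lemma sum_pair (F : T -> nat) x y : x != y ->
  \sum_z F z = F x + F y + \sum_(z | (z != x) && (z != y)) F z.
Proof.
by move=> xy; rewrite (bigD1 x) //= (bigD1 y) 1?eq_sym //= addnA.
Qed.

Definition transfer f x y : T -> nat :=
  fun z => if z == x then (f x).-1 else if z == y then (f y).+1 else f z.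

Lemma sum_transfer (h : nat -> nat) f x y : x != y ->
  \sum_z h (transfer f x y z) =
  h (f x).-1 + h (f y).+1 + \sum_(z | (z != x) && (z != y)) h (f z).
Proof.
move=> xy; rewrite (sum_pair _ xy) /transfer eqxx eq_sym (negPf xy) eqxx.
by congr (_ + _); apply: eq_bigr => z /andP[/negPf-> /negPf->].
Qed.

(* Elements of level 0 are ignored, although they may have up to m lies left. *)
Definition wt (m q j : nat) : nat := if j is 0 then 0 else bsum q (m + j).

Lemma wt_pascal m q j : wt m q j + wt m q j.-1 <= wt m q.+1 j.
Proof.
case: j => //= j; rewrite bsum_pascal addnS /= leq_add2l.
by case: j => //= j; rewrite addnS.
Qed.

(* Two elements of levels a, b with a + b + 2m >= q + 2 already weigh more than
   2 ^ q; below that bound bsum is convex enough for levelling to help. *)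
Lemma transfer_wt m q f x y : 0 < f y -> (f y).+1 < f x ->
  \sum_z wt m q (f z) <= 2 ^ q ->
  \sum_z wt m q (transfer f x y z) <= \sum_z wt m q (f z).
Proof.
move=> y0 yx; have xy : x != y by apply/eqP => E; move: yx; rewrite E; lia.
rewrite (sum_transfer _ _ xy) (sum_pair _ xy) leq_add2r.
case: (f x) yx => [|[|a]] //= yx; case: (f y) y0 yx => //= b _ yx small.
have sum_small : m + a.+2 + (m + b.+1) <= q.+1.
  rewrite leqNgt; apply/negP => big.
  have := bsum_pair (ltn_addl m (ltn0Sn a.+1)) (ltn_addl m (ltn0Sn b)) big.
  by lia.
have := @leq_bin_unimodal q (m + b.+1) (m + a.+1).
by rewrite !(addnS m) !bsumSr; lia.
Qed.

(* By Pascal's rule the weight with q.+1 queries left is the sum of the weights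
   with q left after removing A and after removing S :\: A, so halving S suitably
   gives the induction step for crowded_weight. *)
Lemma balanced_split f k s (S := [set x | 0 < f x]) :
  (forall x y, 0 < f y -> f x <= (f y).+1) ->
  k <= #|S| < 2 * k -> k * s.+2 <= \sum_x f x ->
  exists A, let half B x := f x - (x \in B) in
  [/\ k <= #|[set x | 0 < half A x]| < 2 * k,
      k <= #|[set x | 0 < half (S :\: A) x]| < 2 * k,
      k * s.+1 <= \sum_x half A x, k * s.+1 <= \sum_x half (S :\: A) x &
      A \subset S].
Proof.
move=> bal /andP[kS Sk] Df; pose O := [set x | f x == 1].
have OS : O \subset S by apply/subsetP => x; rewrite !inE => /eqP->.
(* If some level is 1, balance bounds all levels by 2, so the total is at most [2 * #|S| - #|O|]; it
   is at least [2 * k]. *)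
have O_small : #|O| <= 2 * (#|S| - k).
  have [->|[y]] := set_0Vmem O; first by rewrite cards0.
  rewrite inE => /eqP fy.
  have : \sum_x (f x + (x \in O)) <= \sum_x 2 * (x \in S).
    apply: leq_sum => x _; rewrite !inE.
    have := bal x y; rewrite fy; move/(_ isT).
    by case: (f x) => [|[|[|]]].
  by rewrite big_split -big_distrr /= !sum_mem; nia.
(* [A] takes half of [O] and half of the rest; even with both halves rounded down, [#|S| < 2 * k]
   keeps [S :\: A] within [k]. *)
have [A1 A1O cA1] := @subset_card_ex O (#|O|./2) ltac:(lia).
have cSO : #|S :\: O| = #|S| - #|O| by rewrite cardsD (setIidPr OS).
have [A2 A2O cA2] := @subset_card_ex (S :\: O) ((#|S| - #|O|)./2) ltac:(lia).
(* Only elements of [O] can lose their last level. *)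
have key B : B \subset S -> #|B| <= k -> #|B :&: O| <= #|S| - k ->
    k <= #|[set x | 0 < f x - (x \in B)]| < 2 * k /\
    k * s.+1 <= \sum_x (f x - (x \in B)).
  move=> BS Bk BO.
  have -> : [set x | 0 < f x - (x \in B)] = S :\: (B :&: O).
    by apply/setP => x; rewrite !inE; case: (x \in B) => /=; lia.
  have -> : #|S :\: (B :&: O)| = #|S| - #|B :&: O|.
    by rewrite cardsD (setIidPr _) // subIset // BS.
  split; first by lia.
  have : \sum_x f x = \sum_x (f x - (x \in B)) + \sum_x ((x \in B) : nat).
    rewrite -big_split; apply: eq_bigr => x _ /=; rewrite subnK //.
    by case xB: (x \in B) => //; move/subsetP/(_ x xB): BS; rewrite inE.
  by rewrite sum_mem; lia.
have dA : [disjoint A1 & A2].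
  apply: disjointWl A1O _; apply: disjointWr A2O _.
  rewrite -setI_eq0; apply/eqP/setP => x; rewrite !inE.
  by case: (f x == 1); rewrite ?andbF.
pose A := A1 :|: A2.
have AS : A \subset S.
  by rewrite subUset (subset_trans A1O OS) (subset_trans A2O) // subsetDl.
have cA : #|A| = #|O|./2 + (#|S| - #|O|)./2.
  by rewrite cardsU (disjoint_setI0 dA) cards0 subn0 cA1 cA2.
have AO : A :&: O = A1.
  apply/setP => x; rewrite !inE; move/subsetP/(_ x): A1O; move/subsetP/(_ x): A2O.
  rewrite !inE; case: (x \in A1) => /=; first by move=> _ ->.
  by case: (x \in A2) => //= /(_ isT)/andP[/negPf->].
have cOS := subset_leq_card OS.
have [||cardA sumA] := key A AS; rewrite ?AO ?cA ?cA1; try lia.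
have [||cardSA sumSA] := key (S :\: A) (subsetDl _ _).
- by rewrite cardsD (setIidPr AS) cA; lia.
- have -> : (S :\: A) :&: O = O :\: A1.
    rewrite -AO; apply/setP => x; rewrite !inE; move/subsetP/(_ x): OS; rewrite !inE.
    by case: (f x == 1) => //=; rewrite ?andbF // => ->; rewrite ?andbT.
  by rewrite cardsD (setIidPr A1O) cA1; lia.
exists A; split=> //.
Qed.

(** For [s = 0], [k] elements of level 1 already outweigh [2 ^ q]. Otherwise levelling leads to a
    balanced position, which splits into two instances for [s - 1]. *)
Lemma crowded_weight f k q m s (S := [set x | 0 < f x]) :
  2 ^ q < k * bsum q m.+1 -> k <= #|S| < 2 * k -> k * s.+1 <= \sum_x f x ->
  2 ^ (q + s) < \sum_x wt m (q + s) (f x).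
Proof.
rewrite {}/S => kq; elim: s f => [|s IHs] f.
  move=> /andP[kS _] _; rewrite addn0; apply: (leq_trans kq).
  apply: leq_trans (_ : \sum_x (x \in [set x | 0 < f x]) * bsum q m.+1 <= _).
    by rewrite -big_distrl sum_mem leq_mul2r kS orbT.
  apply: leq_sum => x _; rewrite inE; case: (f x) => //= j.
  by rewrite mul1n; apply: leq_bsum; lia.
(* Levelling ends because each transfer lowers the sum of squares. *)
have [N] := ubnP (\sum_x f x ^ 2); elim: N f => // N IHN f leN cS Df.
have [/existsP[x /existsP[y /andP[y0 yx]]]|bal] :=
    boolP [exists x, exists y, (0 < f y) && ((f y).+1 < f x)].
  have xy : x != y by apply/eqP => E; move: yx; rewrite E; lia.
  rewrite ltnNge; apply/negP => small.
  have := transfer_wt y0 yx small.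
  apply/negP; rewrite -ltnNge; apply: (leq_ltn_trans small).
  have sum_id h : \sum_z h (transfer f x y z) = _ := sum_transfer h f xy.
  apply: IHN.
  - rewrite (sum_id (fun j => j ^ 2)); move: leN.
    by rewrite (sum_pair _ xy) !expnS !expn0; nia.
  - rewrite (_ : [set z | _] = [set z | 0 < f z]) //.
    apply/setP => z; rewrite !inE /transfer.
    by case: eqP => [->|_]; [lia|case: eqP => [->|_] //; lia].
  - rewrite (sum_id id); move: Df; rewrite (sum_pair _ xy); lia.
have {}bal x y : 0 < f y -> f x <= (f y).+1.
  move=> y0; rewrite leqNgt; apply: contra bal => yx.
  by apply/existsP; exists x; apply/existsP; exists y; rewrite y0.
have [A [cA cSA sA sSA AS]] := balanced_split bal cS Df.
have wA := IHs _ cA sA; have wSA := IHs _ cSA sSA.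
rewrite addnS expnS.
apply: leq_trans (_ : \sum_x wt m (q + s) (f x - (x \in A)) +
  \sum_x wt m (q + s) (f x - (x \in [set x | 0 < f x] :\: A)) <= _); first by lia.
rewrite -big_split; apply: leq_sum => x _ /=; rewrite !inE.
apply: leq_trans (wt_pascal _ _ _); rewrite -subn1.
move/subsetP/(_ x): AS; rewrite inE; case: (x \in A) => /= [_|_].
  by rewrite subn0 addnC.
by rewrite subn0; case: (f x).
Qed.

End Transfer.

(** * Balanced splits of the weight *)

(* Greedy: each element joins the lighter side. *)
Lemma balanced_subset (T : finType) (d : T -> nat) c (S : {set T}) :
  (forall x, x \in S -> d x <= c) -> exists B : {set T},
  [/\ B \subset S, \sum_(x in B) d x <= \sum_(x in S :\: B) d x + c &
      \sum_(x in S :\: B) d x <= \sum_(x in B) d x + c].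
Proof.
have [N] := ubnP #|S|; elim: N S => // N IHN S SN dc.
have [S0|[x xS]] := set_0Vmem S.
  by exists set0; rewrite S0 setD0 !big_set0 sub0set.
have Sx : #|S :\ x| < N by have := cardsD1 x S; rewrite xS; lia.
have [y /setD1P[_ yS]|B [BS B1 B2]] := IHN _ Sx; first exact: dc.
have xB : x \notin B by apply/negP => /(subsetP BS); rewrite !inE eqxx.
have dx := dc x xS.
have E1 : S :\: (x |: B) = (S :\ x) :\: B.
  by apply/setP => z; rewrite !inE negb_or; case: (z == x); case: (z \in B).
have E2 : S :\: B = x |: ((S :\ x) :\: B).
  apply/setP => z; rewrite !inE; have [->|] //= := eqVneq z x.
  by rewrite xS xB.
have [le|lt] := leqP (\sum_(z in B) d z) (\sum_(z in (S :\ x) :\: B) d z).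
  exists (x |: B); rewrite E1 big_setU1 //=; split; try lia.
  by rewrite subUset sub1set xS (subset_trans BS) // subD1set.
exists B; rewrite E2 big_setU1 ?inE ?eqxx ?andbF //=; split; try lia.
by rewrite (subset_trans BS) // subD1set.
Qed.

(* x and y go to different sides, the others are distributed greedily; the
   imbalance is at most 'C(q, M.-1) since no other increment exceeds it. *)
Lemma split_tops (T : finType) (v : T -> nat) q M x y :
  y != x -> (forall z, v z <= M) -> v x = M -> v y = M -> 0 < M ->
  \sum_z bsum q.+1 (v z) < 2 ^ q.+1 + bsum q.+1 M ->
  exists A : {set T}, [/\ A \subset [set z | 0 < v z], x \in A, y \notin A,
    \sum_z bsum q (v z - (z \notin A)) < 2 ^ q + bsum q M &
    \sum_z bsum q (v z - (z \in A)) < 2 ^ q + bsum q M].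
Proof.
move=> yx vM vx vy M0 w.
(* [d z] is the weight that [z] keeps only if the answer agrees with it, so the two successors
   differ by the imbalance of [d]. *)
pose d z := bsum q (v z) - bsum q (v z).-1.
have dE z : bsum q (v z) = bsum q (v z).-1 + d z.
  by rewrite subnKC // leq_bsum // leq_pred.
have dM z : 0 < v z -> d z = 'C(q, (v z).-1).
  by rewrite /d; case: (v z) => // j _; rewrite bsumSr /=; lia.
pose S := [set z | 0 < v z] :\ x :\ y.
have [z /setD1P[zy /setD1P[zx]]|B [BS B1 B2]] := @balanced_subset _ d 'C(q, M.-1) S.
  rewrite inE => vz; rewrite dM //; apply: leq_bin_unimodal.
    by have := vM z; lia.
  (* Otherwise [z] and [x] together weigh at least [2 ^ q.+1], and [y] takes the total to the
     excluded bound. *)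
  rewrite leqNgt; apply/negP => big.
  have : bsum q.+1 (v z) + bsum q.+1 M + bsum q.+1 M < 2 ^ q.+1 + bsum q.+1 M.
    apply: leq_ltn_trans w; rewrite (sum_pair _ yx) vx vy (bigD1 z) ?zx ?zy //=; lia.
  have := @leq_bsum q.+1 (q.+2 - M) (v z); have := bsum_compl q.+1 M; lia.
have xB : x \notin B by apply/negP => /(subsetP BS); rewrite !inE eqxx andbF.
have yB : y \notin B by apply/negP => /(subsetP BS); rewrite !inE eqxx.
pose A := x |: B.
have AV : A \subset [set z | 0 < v z].
  rewrite subUset sub1set inE vx M0 (subset_trans BS) //.
  by rewrite (subset_trans (subD1set _ _)) // subD1set.
have Adiff : \sum_(z in A) d z <= \sum_(z in ~: A) d z + 'C(q, M.-1) /\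
             \sum_(z in ~: A) d z <= \sum_(z in A) d z + 'C(q, M.-1).
  have -> : \sum_(z in ~: A) d z = d y + \sum_(z in S :\: B) d z.
    rewrite (bigD1 y) ?inE ?negb_or ?yx //=; congr (_ + _).
    rewrite [LHS]big_mkcond [RHS]big_mkcond /=; apply: eq_bigr => z _.
    rewrite !inE negb_or; case: (z == x) => //=; case: (z \in B) => //=;
      rewrite ?andbF // ?andbT; case: (z == y) => //=.
    by case: posnP => // vz; rewrite /d vz bsum0.
  by rewrite big_setU1 //= !dM ?vx ?vy //; lia.
have tot : \sum_z bsum q.+1 (v z) =
    2 * \sum_z bsum q (v z).-1 + \sum_(z in A) d z + \sum_(z in ~: A) d z.
  have -> : \sum_(z in ~: A) d z = \sum_(z | z \notin A) d z.
    by apply: eq_bigl => z; rewrite !inE.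
  rewrite -addnA -(bigID [in A] xpredT) /= mul2n -addnn -addnA -!big_split /=.
  by apply: eq_bigr => z _; rewrite bsum_pascal dE /=; lia.
have yesE : \sum_z bsum q (v z - (z \notin A)) =
    \sum_z bsum q (v z).-1 + \sum_(z in A) d z.
  rewrite [\sum_(z in A) _]big_mkcond -big_split /=; apply: eq_bigr => z _.
  by case: (z \in A); rewrite ?subn0 ?subn1 ?addn0 ?dE.
have noE : \sum_z bsum q (v z - (z \in A)) =
    \sum_z bsum q (v z).-1 + \sum_(z in ~: A) d z.
  rewrite [\sum_(z in ~: A) _]big_mkcond -big_split /=; apply: eq_bigr => z _.
  by rewrite in_setC; case: (z \in A); rewrite ?subn0 ?subn1 ?addn0 ?dE.
have bM : bsum q M = bsum q M.-1 + 'C(q, M.-1).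
  by case: (M) M0 => // j _; rewrite bsumSr.
(* Half of total plus imbalance stays below the new bound, since
   [bsum q.+1 M + 'C(q, M.-1) = 2 * bsum q M]. *)
move: w; rewrite tot bsum_pascal expnS => w.
exists A; rewrite yesE noE; split=> //; try lia.
- by rewrite !inE eqxx.
- by rewrite !inE (negPf yx) (negPf yB).
Qed.

(** * Positions of the game and the lower bound *)

Section Game.
Variable n : nat.
Implicit Types (v : 'I_n -> nat) (A S U : {set 'I_n}) (t : strategy n).

(* A position is recorded by v : v x is one more than the number of lies still
   available if x is the sought number, and 0 if x is already excluded. *)
Definition wins v t : Prop :=
  forall x ans, lies x t ans < v x -> announced t ans = x.

Definition after_yes A v : 'I_n -> nat := fun x => v x - (x \notin A).
Definition after_no A v : 'I_n -> nat := fun x => v x - (x \in A).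

Lemma wins_Ask v A ty tn :
  wins v (Ask A ty tn) <-> wins (after_yes A v) ty /\ wins (after_no A v) tn.
Proof.
split=> [w|[wy wn] x ans] /=.
  split=> x ans; [have := w x (fun i => if i is j.+1 then ans j else true)
                 |have := w x (fun i => if i is j.+1 then ans j else false)];
    rewrite /after_yes /after_no /=; case: (x \in A) => /= h lx; apply: h;
    rewrite ?eqxx /= ?add0n ?add1n -[[eta ans]]/ans; lia.
case: (ans 0) => lx; [apply: wy | apply: wn]; move: lx;
  rewrite /after_yes /after_no; case: (x \in A) => /=; lia.
Qed.

(** Conservation of Berlekamp's weight: Pascal's rule for each number. *)
Lemma sum_bsum_after A v q :
  \sum_x bsum q (after_yes A v x) + \sum_x bsum q (after_no A v x) =
  \sum_x bsum q.+1 (v x).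
Proof.
rewrite -big_split; apply: eq_bigr => x _ /=.
rewrite bsum_pascal /after_yes /after_no -subn1.
by case: (x \in A); rewrite subn0 // addnC.
Qed.

(** At an announcement only one number can be alive; conservation carries the bound up the tree. *)
Lemma wins_weight v t q : wins v t -> max_queries t <= q ->
  \sum_x bsum q (v x) <= 2 ^ q.
Proof.
elim: t v q => [y|A ty IHy tn IHn] v q w /=.
  move=> _; rewrite (bigD1 y) //= big1 ?addn0 ?bsum_le_exp // => x xy.
  suff -> : v x = 0 by rewrite bsum0.
  apply/eqP; rewrite -leqn0 leqNgt; apply: contra xy => vx.
  by have /= -> := w x (fun=> true) vx.
have [wy wn] := (wins_Ask _ _ _ _).1 w.
case: q => // q; rewrite ltnS geq_max => /andP[qy qn].
by rewrite -(sum_bsum_after A) expnS mul2n -addnn leq_add //; [apply: IHy|apply: IHn].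
Qed.

(* The Responder says NO as long as this leaves at least k numbers with more
   than m lies available, and then follows the heavier of the two answers. *)
Lemma wins_long k q m s v t (f := fun x => v x - m) :
  1 < k -> 2 ^ q < k * bsum q m.+1 -> queries_bounded k t -> wins v t ->
  k <= #|[set x | 0 < f x]| -> k * s.+1 <= \sum_x f x -> q + s < max_queries t.
Proof.
move=> k1 kq.
have wtE (u : 'I_n -> nat) N : \sum_x wt m N (u x - m) <= \sum_x bsum N (u x).
  by apply: leq_sum => x _; case E: (u x - m) => //=; apply: leq_bsum; lia.
rewrite {}/f; elim: t v s => [y|A ty _ tn IHn] v s /= bt w kS kD.
  have [x] : exists x, x \in [set x | 0 < v x - m] :\ y.
    apply/set0Pn; rewrite -card_gt0.
    have := cardsD1 y [set x | 0 < v x - m]; rewrite /= => E.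
    by move: kS; rewrite E; case: (y \in _) => /=; lia.
  rewrite !inE => /andP[xy vx].
  by move: xy; have /= -> := w x (fun=> true) (leq_trans vx (leq_subr _ _)); rewrite eqxx.
have [small|large] := ltnP #|[set x | 0 < v x - m]| (2 * k).
  rewrite ltnNge; apply/negP => /(wins_weight w).
  have := @crowded_weight _ (fun x => v x - m) k q m s kq.
  by rewrite kS small => /(_ isT kD); have := wtE v (q + s); lia.
move: bt => /and3P[Ak _ bn]; have [_ wn] := (wins_Ask _ _ _ _).1 w.
have vnE : (fun x => after_no A v x - m) =1 (fun x => v x - m - (x \in A)).
  by move=> x; rewrite subnAC.
have kS' : k <= #|[set x | 0 < after_no A v x - m]|.
  rewrite -(leq_add2r k) addnn -mul2n.
  apply: leq_trans large (leq_trans (card_remove _ A) (leq_add _ Ak)).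
  by apply/subset_leq_card/subsetP => x; rewrite !inE -vnE.
have kD' r : k * r.+2 <= \sum_x (v x - m) -> k * r.+1 <= \sum_x (after_no A v x - m).
  move=> h; rewrite -(leq_add2r k) -mulnSr.
  apply: leq_trans h (leq_trans (sum_remove _ A) (leq_add _ Ak)).
  by rewrite (eq_bigr _ (fun x _ => vnE x)).
case: s kD => [_|s kD]; last first.
  have := IHn _ s bn wn kS' (kD' _ kD); lia.
(* With no surplus left, the [k] positive levels alone provide the total [k]. *)
have := IHn _ 0 bn wn kS'; rewrite addn0.
have : k * 1 <= \sum_x (after_no A v x - m).
  rewrite muln1; apply: leq_trans kS' _; rewrite -sum_mem.
  by apply: leq_sum => x _; rewrite inE; case: (_ - _).
move=> h /(_ h); lia.
Qed.

(** * Query budgets and the search inside one block *)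

Definition solvable k Q v : Prop :=
  exists t, [/\ queries_bounded k t, wins v t & max_queries t <= Q].

Lemma solvable_mono k Q Q' v v' : Q <= Q' -> (forall x, v' x <= v x) ->
  solvable k Q v -> solvable k Q' v'.
Proof.
move=> QQ vv [t [bt w tQ]]; exists t; split=> // [x ans lx|].
  by apply: w; apply: leq_trans lx (vv x).
exact: leq_trans tQ QQ.
Qed.

Lemma solvable_Ask k Q v A : #|A| <= k -> solvable k Q (after_yes A v) ->
  solvable k Q (after_no A v) -> solvable k Q.+1 v.
Proof.
move=> Ak [ty [by_ wy qy]] [tn [bn wn qn]]; exists (Ask A ty tn); split=> /=.
- by rewrite Ak by_.
- exact/wins_Ask.
- by rewrite ltnS geq_max qy.
Qed.

Lemma solvable_single k Q v y : (forall x, x != y -> v x = 0) -> solvable k Q v.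
Proof.
move=> vy; exists (Announce y); split=> // x ans /=.
by have [->//|yx] := eqVneq y x; rewrite vy // eq_sym.
Qed.


(* The slack bsum q M, the weight of one element of top level, absorbs the
   imbalance of every split. When only one top element x is left, the query
   [set x] either halves the weight of the others or lowers the top level. *)
Lemma endgame k q M v x :
  #|[set z | 0 < v z]| <= k -> (forall z, v z <= M) -> v x = M ->
  0 < M -> \sum_z bsum q (v z) < 2 ^ q + bsum q M -> solvable k (q + M.-1) v.
Proof.
have [N] := ubnP (q + M); elim: N q M v x => // N IHN q M v x qMN alive vM vx M0 w.
have [/existsP[y /andP[yx vy]]|single] :=
    boolP [exists y, (y != x) && (0 < v y)]; last first.
  apply: (@solvable_single _ _ _ x) => y yx; apply/eqP; rewrite -leqn0 leqNgt.
  by apply: contra single => vy; apply/existsP; exists y; rewrite yx.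
have alive_after u : (forall z, u z <= v z) -> #|[set z | 0 < u z]| <= k.
  move=> uv; apply: leq_trans alive; apply/subset_leq_card/subsetP => z.
  by rewrite !inE => /leq_trans; apply.
have le_yes A z : after_yes A v z <= v z by rewrite leq_subr.
have le_no A z : after_no A v z <= v z by rewrite leq_subr.
case: q w qMN => [|q] w qMN.
  move: w; rewrite (sum_pair _ yx) vx; have := bsum_gt0 0 vy; rewrite expn0; lia.
have [/existsP[{yx vy}y /andP[yx /eqP vy]]|top1] :=
    boolP [exists y, (y != x) && (v y == M)].
  have [A [AV xA yA yesA noA]] := split_tops yx vM vx vy M0 w.
  rewrite addSn; apply: (@solvable_Ask _ _ _ A).
  - exact: leq_trans (subset_leq_card AV) alive.
  - apply: (IHN _ _ _ x) => //.
    + exact: alive_after.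
    + by move=> z; apply: leq_trans (vM z).
    + by rewrite /after_yes xA subn0.
  - apply: (IHN _ _ _ y) => //.
    + exact: alive_after.
    + by move=> z; apply: leq_trans (vM z).
    + by rewrite /after_no (negPf yA) subn0.
have {}top1 z : z != x -> v z < M.
  move=> zx; rewrite ltn_neqAle vM andbT; apply: contra top1 => vz.
  by apply/existsP; exists z; rewrite zx.
have M1 := leq_ltn_trans vy (top1 y yx).
have sumD1 (h : 'I_n -> nat) : \sum_z h z = h x + \sum_(z | z != x) h z.
  by rewrite (bigD1 x).
rewrite addSn; apply: (@solvable_Ask _ _ _ [set x]).
- by apply: leq_trans alive; rewrite subset_leq_card // sub1set inE vx.
- apply: (IHN _ _ _ x) => //.
  + exact: alive_after.
  + by move=> z; apply: leq_trans (vM z).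
  + by rewrite /after_yes !inE eqxx subn0.
  + move: w; rewrite !sumD1 /after_yes !inE eqxx subn0 vx expnS.
    have : 2 * \sum_(z | z != x) bsum q (v z - (z \notin [set x])) <=
           \sum_(z | z != x) bsum q.+1 (v z).
      rewrite big_distrr /=; apply: leq_sum => z zx; rewrite inE zx subn1.
      by rewrite bsum_pascal mul2n -addnn leq_add2r leq_bsum // leq_pred.
    move=> half; rewrite [X in X < _ -> _]addnC [X in _ -> X < _]addnC !ltn_add2r.
    by move=> w; rewrite -(@ltn_pmul2l 2) //; apply: leq_ltn_trans half w.
(* This query is charged to [M] instead of [q]: the weight of [x] and the slack fall by the same
   amount. *)
- have -> : q + M.-1 = q.+1 + M.-1.-1 by lia.
  apply: (IHN _ _ _ x) => //; first by lia.
  + exact: alive_after.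
  + move=> z; rewrite /after_no inE; have [->|/top1] := eqVneq z x; last by lia.
    by rewrite vx subn1.
  + by rewrite /after_no inE eqxx vx subn1.
  + by lia.
  + move: w; rewrite !sumD1 /after_no !inE eqxx subn1 vx.
    have -> : \sum_(z | z != x) bsum q.+1 (v z - (z \in [set x])) =
              \sum_(z | z != x) bsum q.+1 (v z).
      by apply: eq_bigr => z zx; rewrite inE (negPf zx) subn0.
    lia.
Qed.

(** The live numbers weigh at most [2 ^ q], which leaves all the slack of [endgame]; that lemma
    needs an attained top level, hence the maximum of [v] in place of [M]. *)
Lemma solvable_within (x0 : 'I_n) k q M v A : #|A| <= k -> k * bsum q M <= 2 ^ q ->
  (forall x, v x <= M) -> (forall x, x \notin A -> v x = 0) ->
  solvable k (q + M.-1) v.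
Proof.
move=> Ak kq vM vA.
have alive : #|[set z | 0 < v z]| <= k.
  apply: leq_trans Ak; apply/subset_leq_card/subsetP => x.
  by rewrite inE; apply: contraTT => /vA->.
have [x _ vx] := @arg_maxnP _ x0 xpredT v isT.
have [v0|v0] := posnP (v x).
  apply: (@solvable_single _ _ _ x0) => y _; apply/eqP.
  by rewrite -leqn0 -v0; apply: vx.
apply: (@solvable_mono _ (q + (v x).-1) _ v) => //; first by have := vM x; lia.
apply: (@endgame _ _ _ _ x) => // [z|]; first exact: vx.
apply: (@leq_ltn_trans (2 ^ q)); last by have := bsum_gt0 q v0; lia.
apply: leq_trans kq; apply: leq_trans (leq_mul alive (leqnn _)).
rewrite -sum_mem big_distrl /=; apply: leq_sum => z _; rewrite inE.
by case: posnP => [->|_]; rewrite ?bsum0 // mul1n leq_bsum.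
Qed.

End Game.

(** * The cyclic sweep through blocks *)

(** Provides the next block: it lies in the remainder [U] of the round, or uses [U] up and continues
    into the next round. *)
Lemma comparable_set_ex (T : finType) (U : {set T}) k : k <= #|T| ->
  exists A : {set T}, #|A| = k /\ ((A \subset U) || (U \subset A)).
Proof.
move=> kT; have [kU|Uk] := leqP k #|U|.
  by have [A AU cA] := subset_card_ex kU; exists A; rewrite AU.
have cC := cardsC U.
have [B BU cB] := @subset_card_ex _ (~: U) (k - #|U|) ltac:(lia).
exists (U :|: B); rewrite subsetUl orbT; split=> //.
rewrite cardsU disjoint_setI0 ?cards0 ?cB; first by lia.
by rewrite disjoint_sym disjoints_subset.
Qed.

Lemma card_setCD (T : finType) (A U : {set T}) :
  U \subset A -> #|A| + #|~: (A :\: U)| = #|T| + #|U|.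
Proof.
move=> UA; have := cardsC (A :\: U); have := subset_leq_card UA.
by rewrite cardsD (setIidPr UA); lia.
Qed.

Section Sweep.
Variables (n : nat) (x0 : 'I_n) (l k X : nat) (w : nat -> nat).
Hypotheses (k0 : 0 < k) (kn : k <= n).
Hypothesis wP : forall p, p <= l -> k * bsum (w p) (l - p).+1 <= 2 ^ w p.
Hypothesis XP : forall p, p <= l -> (p.+1 * n) %/ k - 1 + w p + 2 * l + 1 <= X.
Implicit Types (U A : {set 'I_n}).

(* The position when H.-1 lies are left, numbers in U have been queried p times
   and the others p.+1 times (always with answer NO), and on top of that A has
   been answered YES e times. *)
Definition sweep_pos H p U A e : 'I_n -> nat :=
  fun x => H - (p + (x \notin U)) - (x \notin A) * e.

(** [r] counts the queries answered NO that cancelled no YES. Besides these, each cancelled YES has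
    cost two queries and one lie of every number, and [e] YES answers are pending. The nested
    induction follows the answers: a cancelling NO lowers [H], any other NO raises [r], a YES raises
    [e]. *)
Lemma sweep_solvable H p U A r e Q :
  H <= l.+1 -> #|A| = k -> (A \subset U) || (U \subset A) -> U != set0 ->
  k * r + #|U| = p.+1 * n -> e <= H - (p + (U \subset A)) ->
  X <= Q + r + 2 * (l.+1 - H) + e ->
  solvable k Q (sweep_pos H p U A e).
Proof.
have dead H' p' U' A' e' Q' : H' <= p' -> solvable k Q' (sweep_pos H' p' U' A' e').
  by move=> Hp; apply: (@solvable_single _ _ _ _ x0) => x _; rewrite /sweep_pos; lia.
elim: H p U A r e Q => [|H IHH] p U A r e Q; first by move=> *; exact: dead.
move=> Hl; have [m] := ubnP (H.+1 * n - r).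
elim: m p U A r e Q => // m IHm p U A r e Q mP cA AU U0 Ur.
have [d] := ubnP (H.+1 - e); elim: d e Q => // d IHd e Q dP eP XQ.
have [Hp|pH] := leqP H.+1 p; first exact: dead.
have U1 : 0 < #|U| by rewrite card_gt0.
have pl : p <= l by lia.
have fl0 : 0 < p.+1 * n %/ k by rewrite divn_gt0 // mulSn; lia.
have r_le : r <= p.+1 * n %/ k by rewrite leq_divRL // -Ur mulnC leq_addr.
(* Unless [A] uses up [U], the round has a further query in store; it pays for the extra YES that
   excludes the rest of [U]. *)
have r_lt : ~~ (U \subset A) -> r < p.+1 * n %/ k.
  move=> UA; rewrite leq_divRL // -Ur mulSn addnC mulnC leq_add2l.
  by rewrite -cA subset_leq_card //; case/orP: AU UA => // ->.
have XQ' := XP pl.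
(* At equality every number outside [A] is excluded, and the search goes on inside [A]. *)
have [eM|eM] := eqVneq e (H.+1 - (p + (U \subset A))).
  apply: (@solvable_mono _ _ (w p + (H.+1 - p).-1) _ (sweep_pos H.+1 p U A e)) => //.
    by move: eM r_lt; case: (U \subset A) => /= eM r_lt; have := r_lt; lia.
  apply: (@solvable_within _ x0 _ _ _ _ A) => [|||x xA].
  - by rewrite cA.
  - by apply: leq_trans (wP pl); rewrite leq_mul2l leq_bsum ?orbT //; lia.
  - by move=> x; rewrite /sweep_pos; lia.
  rewrite /sweep_pos xA mul1n eM.
  have : (U \subset A) -> x \notin U by move=> UA; apply: contra xA; apply/subsetP.
  by case: (U \subset A) => [/(_ isT)-> //|_]; lia.
have e_lt : e < H.+1 - (p + (U \subset A)) by rewrite ltn_neqAle eM.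
have [Q' QE] : exists Q', Q = Q'.+1.
  exists Q.-1; rewrite prednK //.
  by move: e_lt r_lt; case: (U \subset A) => /= e_lt r_lt; have := r_lt; lia.
rewrite QE; apply: (@solvable_Ask _ _ _ _ A); first by rewrite cA.
  apply: (@solvable_mono _ _ Q' _ (sweep_pos H.+1 p U A e.+1)) => //.
    by move=> x; rewrite /after_yes /sweep_pos; case: (x \in A) => /=; lia.
  by apply: IHd; lia.
case: e {IHd} dP eP XQ eM e_lt => [|e] dP eP XQ eM e_lt; last first.
  apply: (@solvable_mono _ _ Q' _ (sweep_pos H p U A e)) => //.
    by move=> x; rewrite /after_no /sweep_pos; case: (x \in A) => /=; lia.
  by apply: (IHH p U A r) => //; lia.
have rH : r < H.+1 * n.
  rewrite -(ltn_pmul2l k0); have : k * r < p.+1 * n by rewrite -Ur -addn1 leq_add2l.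
  by move/leq_trans; apply; nia.
(* If [A] uses up [U], a new round begins in which [A :\: U] has already been asked. *)
have [p' [U' [U'0 U'r pos]]] : exists p' U', [/\ U' != set0,
    k * r.+1 + #|U'| = p'.+1 * n &
    forall x, p' + (x \notin U') <= p + (x \notin U) + (x \in A)].
  have [UA|UA] := boolP (U \subset A).
    exists p.+1, (~: (A :\: U)); split.
    - by case/set0Pn: U0 => x xU; apply/set0Pn; exists x; rewrite !inE xU.
    - have := card_setCD UA; rewrite cA card_ord mulnS [_.+2 * _]mulSn -Ur => E.
      by rewrite [k + _]addnC -addnA E addnCA.
    - move=> x; rewrite !inE; have /subsetP/(_ x) := UA.
      by case: (x \in U) => [->|_]; case: (x \in A); rewrite /=; lia.
  have {}AU : A \subset U by case/orP: AU UA => // ->.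
  exists p, (U :\: A); split.
  - by rewrite setD_eq0.
  - rewrite cardsD (setIidPr AU) cA -Ur mulnS.
    by rewrite addnAC subnKC 1?addnC // -cA subset_leq_card.
  - by move=> x; rewrite !inE; case: (x \in U); case: (x \in A); rewrite /=; lia.
have [A' [cA' AU']] := @comparable_set_ex _ U' k ltac:(by rewrite card_ord).
apply: (@solvable_mono _ _ Q' _ (sweep_pos H.+1 p' U' A' 0)) => //.
  by move=> x; rewrite /after_no /sweep_pos !muln0 !subn0 -subnDA leq_sub2l.
by apply: (IHm p' U' A' r.+1) => //; lia.
Qed.

Lemma sweep_start : solvable k X (fun _ : 'I_n => l.+1).
Proof.
have [A [cA AU]] := @comparable_set_ex _ [set: 'I_n] k ltac:(by rewrite card_ord).
apply: (@solvable_mono _ _ X _ (sweep_pos l.+1 0 setT A 0)) => //.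
  by move=> x; rewrite /sweep_pos inE; lia.
apply: (@sweep_solvable _ _ _ _ 0) => //; last by lia.
- by apply/set0Pn; exists x0; rewrite inE.
- by rewrite cardsT card_ord muln0 mul1n.
Qed.

End Sweep.

(** * The two bounds on [RU] *)

Lemma binom_leE q l : binom_le q l = bsum q l.+1.
Proof. by []. Qed.

Lemma weight_bound_least l n (q := weight_bound l n) :
  n * bsum q l.+1 <= 2 ^ q /\ forall r, n * bsum r l.+1 <= 2 ^ r -> q <= r.
Proof.
have [] := weight_bound_is_least l n; rewrite weight_boundE => Wq Wmin.
by split=> // r; rewrite -binom_leE -weight_boundE => /Wmin.
Qed.

Theorem corollary5 (l k n : nat) (k_ge1 : 1 <= k) (n_ge1 : 1 <= n)
    (k_gt1 : 1 < k) (k_lt_half : k < n %/ 2) :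
  L_tilde l k n <= RU l k n <= L_tilde l k n + 2 * l + 1.
Proof.
have kn : k <= n by apply: leq_trans (ltnW k_lt_half) (leq_div _ _).
have [[t [bt ft <-]] RUmin] := RU_is_least l k_ge1 n_ge1.
apply/andP; split.
  apply/bigmax_leqP => -[p pl] _ /=; rewrite ltnS in pl.
  have [Wq Wmin] := weight_bound_least (l - p) k.
  (* The weight bound is positive as [k > 1]; its predecessor [q] violates the weight inequality, as
     [wins_long] requires. *)
  case: (weight_bound _ _) Wq Wmin => [|q].
    by have := bsum_gt0 0 (ltn0Sn (l - p)); rewrite expn0; nia.
  move=> _ /(_ q); rewrite ltnn => Wq.
  have kq : 2 ^ q < k * bsum q (l - p).+1 by rewrite ltnNge; apply/negP => /Wq.
  have fl0 : 0 < p.+1 * n %/ k by rewrite divn_gt0 // mulSn; lia.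
  have lp : l.+1 - (l - p) = p.+1 by lia.
  (* All levels start at [p.+1], so [s.+1] is the quotient of [p.+1 * n] by [k]. *)
  rewrite addnS addnC; apply: (@wins_long n k q (l - p) _ (fun=> l.+1) t) => //.
  - rewrite (_ : [set x | _] = setT) ?cardsT ?card_ord //.
    by apply/setP => x; rewrite !inE lp.
  - by rewrite sum_nat_const lp card_ord subn1 prednK // mulnC (mulnC n) leq_divM.
have [t' [bt' wt' qt']] :
    solvable k (L_tilde l k n + 2 * l + 1) (fun _ : 'I_n => l.+1).
  pose W p := weight_bound (l - p) k.
  apply: (sweep_start (Ordinal n_ge1) k_ge1 kn (w := W)).
    by move=> p _; have [] := weight_bound_least (l - p) k.
  move=> p pl; rewrite !leq_add2r.
  pose F (i : 'I_l.+1) := i.+1 * n %/ k - 1 + weight_bound (l - i) k.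
  by apply: (@leq_bigmax_cond _ xpredT F (Ordinal (pl : p < l.+1))).
by apply: leq_trans qt'; apply: RUmin; exists t'; split.
Qed.
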